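(* Let $n\ge1$, $k\ge2$, $\mathbb{K}\in\{\mathbb{R},\mathbb{C}\}$, $\star\in\{H,T\}$, $\epsilon_1,\epsilon_2\in\{1,-1\}$, $\epsilon=\epsilon_1\epsilon_2$. Let $X\in\mathbb{K}^{n\times kn}$, $J\in\mathbb{K}^{kn\times kn}$ be such that $X_L$ is nonsingular, and let $\Gamma\in\mathbb{K}^{kn\times kn}$ be nonsingular with $\Gamma^\star=\epsilon_2\Gamma$, $\Gamma J^\star=\epsilon J\Gamma$, $XJ^r\Gamma X^\star=0$ for $r=0,\ldots,k-2$, and $XJ^{k-1}\Gamma X^\star$ nonsingular. Then the matrices $A_0,\ldots,A_k$ given recursively by $$A_k=(XJ^{k-1}\Gamma X^{\star})^{-1},\qquad A_j=-\sum_{i=j+1}^kA_iXJ^{k-j+i-1}\Gamma X^{\star}A_k,\quad j=k-1,\ldots,0,$$ can be equivalently rewritten as $$A_k=(XJ^{k-1}\Gamma X^{\star})^{-1},\qquad A_{k-1}=-A_kXJ^k\Gamma X^{\star}A_k,\qquad A_j=-A_kXJ^{2k-j-1}\Gamma X^{\star}A_k+g_j,\quad j=0,1,\ldots,k-2,$$ where $$g_j=\sum_{t=1}^{k-j-1}(-1)^{t-1}g_j^{(t)},\qquad g_j^{(t)}=\sum_{(\gamma_1,\ldots,\gamma_{t+1})\in\mathcal{I}_{(t,j)}}A_{\gamma_1}A_k^{-1}A_{\gamma_2}A_k^{-1}\cdots A_k^{-1}A_{\gamma_t}A_k^{-1}A_{\gamma_{t+1}}.$$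
   Context: $A^H$ and $A^T$ denote the conjugate transpose and the transpose; $A^\star$ is whichever is selected by $\star$. $X_L\in\mathbb{K}^{kn\times kn}$ is the matrix obtained by stacking $X,XJ,\ldots,XJ^{k-1}$ (top to bottom). For integers $t$ with $1\le t<k$ and $d\ge0$, $\mathcal{I}_{(t,d)}$ is the set of all ordered $(t+1)$-tuples $(\gamma_1,\ldots,\gamma_{t+1})$ of integers with $1\le\gamma_i\le k-1$ for all $i$ and $\sum_{i=1}^{t+1}\gamma_i=tk+d$ (all orderings included as distinct tuples). *)

(* Defs.v *)
From HB Require Import structures.
From mathcomp Require Import all_boot all_order all_algebra.
From mathcomp Require Import reals.
From mathcomp Require Import complex.

Set Implicit Arguments.
Unset Strict Implicit.
Unset Printing Implicit Defensive.

Import GRing.Theory.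
Local Open Scope ring_scope.

Inductive scalar_kind := RealScalars | ComplexScalars.

Definition scalars (R : realType) (f : scalar_kind) : fieldType :=
  match f with
  | RealScalars => R
  | ComplexScalars => R[i]
  end.

Definition scalar_conj (R : realType) (f : scalar_kind) :
    scalars R f -> scalars R f :=
  match f return scalars R f -> scalars R f with
  | RealScalars => id
  | ComplexScalars => @conjc R
  end.

Inductive star_kind := StarH | StarT.

Definition star_mx (R : realType) (f : scalar_kind) (s : star_kind) (m n : nat)
    (A : 'M[scalars R f]_(m, n)) : 'M[scalars R f]_(n, m) :=
  match s with
  | StarH => map_mx (@scalar_conj R f) A^T
  | StarT => A^T
  end.

Lemma sum_nat_const_ord (k n : nat) : (\sum_(i < k) n = k * n)%N.
Proof. by rewrite sum_nat_const card_ord. Qed.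

(* The stacked matrix has [\sum_(i < k) n] rows; the cast identifies this
   number with [k * n], so that invertibility can be stated by [unitmx]. *)
Definition stack_mx (K : fieldType) (n k : nat)
    (X : 'M[K]_(n, k * n)) (J : 'M[K]_(k * n)) : 'M[K]_(k * n) :=
  castmx (sum_nat_const_ord k n, erefl (k * n)%N)
    (\mxcol_(i < k) (X *m J ^+ i)).

(* The entries lie in ['I_k], hence are at most [k - 1]. *)
Definition index_set (k t d : nat) : {set t.+1.-tuple 'I_k} :=
  [set c : t.+1.-tuple 'I_k | [forall i, 0 < tnth c i]%N
         & (\sum_(i < t.+1) tnth c i == t * k + d)%N].

Definition gterm (K : fieldType) (n k : nat) (A : nat -> 'M[K]_n)
    (t j : nat) : 'M[K]_n :=
  \sum_(c in index_set k t j)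
    A (tnth c ord0) *m
      \prod_(i < t) (invmx (A k) *m A (tnth c (lift ord0 i))).

Definition gsum (K : fieldType) (n k : nat) (A : nat -> 'M[K]_n)
    (j : nat) : 'M[K]_n :=
  \sum_(1 <= t < k - j) (-1) ^+ t.-1 *: gterm k A t j.

(* Main.v *)
Require Import Defs.
From HB Require Import structures.
From mathcomp Require Import all_boot all_order all_algebra.
From mathcomp Require Import reals.
From mathcomp Require Import complex.
From mathcomp Require Import zify.

Set Implicit Arguments.
Unset Strict Implicit.
Unset Printing Implicit Defensive.

Import GRing.Theory.
Local Open Scope ring_scope.

(* With [a_p = A_k^-1 A_(k-p)] and [m_p = X J^(k-1+p) Gamma X^* A_k], so that
   [a_0 = m_0 = 1], the recursion says that the truncated power series [a] and
   [m] are inverse to each other.  The closed form is the expansion of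
   [a^-1 = (1 + (a - 1))^-1] as a geometric series, the tuples in the index set
   being the compositions of [k - j] read through [p = k - gamma].  Splitting
   off the first factor of every product gives a convolution recursion for
   [g_j], and the two systems then match by descending induction on [j]. *)

Section ConvolutionRecursion.

Variables (K : fieldType) (n k : nat) (A : nat -> 'M[K]_n).

(** Removing [x] leaves the sum [t * k + (d + k - x)]; since [x < k], the subtraction does not
    truncate. *)
Lemma index_set_cons (t d : nat) (x : 'I_k) (c : t.+1.-tuple 'I_k) :
  ([tuple of x :: c] \in index_set k t.+1 d) =
  (0 < x)%N && (c \in index_set k t (d + k - x)).
Proof.
rewrite !inE big_ord_recl tnth0.
under eq_bigr do rewrite tnthS.
have -> : [forall i, 0 < tnth [tuple of x :: c] i]%N =
          (0 < x)%N && [forall i, 0 < tnth c i]%N.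
  apply/forallP/andP => [pos | [x_gt0 /forallP pos] i].
    split; first by have := pos ord0; rewrite tnth0.
    by apply/forallP => i; have := pos (lift ord0 i); rewrite tnthS.
  by case: (unliftP ord0 i) => [i'|] ->; rewrite ?tnth0 ?tnthS.
rewrite -andbA; congr [&& _, _ & _].
by have := ltn_ord x; set S := (\sum_(i < _) _)%N; lia.
Qed.

(** Although [gsum] starts at [t = 1], the case [t = 0] is the base of the recursion on tuple
    length. *)
Lemma gterm0 (j : nat) : (0 < j < k)%N -> gterm k A 0 j = A j.
Proof.
case/andP => j_gt0 j_lt; rewrite /gterm (big_pred1 [tuple Ordinal j_lt]).
  by rewrite big_ord0 mulmx1 tnth0.
move=> c; rewrite !inE big_ord_recl big_ord0 addn0 mul0n add0n.
apply/andP/eqP => [[_ /eqP cE] | ->].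
  apply: eq_from_tnth => i; have -> : i = ord0 by apply: ord1.
  by apply/val_inj; rewrite tnth0; apply: cE.
by split; [apply/forallP => i; rewrite ord1 tnth0 | rewrite tnth0].
Qed.

Lemma gtermS (t j : nat) :
  gterm k A t.+1 j =
  \sum_(i < k | (0 < i)%N) A i *m invmx (A k) *m gterm k A t (j + k - i).
Proof.
pose cons2 (p : 'I_k * t.+1.-tuple 'I_k) := [tuple of p.1 :: p.2].
rewrite /gterm (reindex cons2) /=; last first.
  exists (fun c => (thead c, [tuple of behead c])) => [[x c] _ | c _].
    by congr pair; apply/val_inj.
  by rewrite /cons2 /= -tuple_eta.
under [RHS]eq_bigr do rewrite mulmx_sumr.
rewrite pair_big_dep /=; apply: eq_big => [[x c]|[x c] _] /=.
  by rewrite index_set_cons.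
have tnth_cons2 i : tnth (cons2 (x, c)) (lift ord0 i) = tnth c i.
  exact: tnthS.
rewrite tnth0 big_ord_recl tnth_cons2 -[_ * _]/(_ *m _) -!mulmxA.
by do 3!congr (_ *m _); apply: eq_bigr => i _; rewrite tnth_cons2.
Qed.

(** The index set is empty: [t + 1] entries below [k] sum to at most [t * k + (k - t - 1)], short of
    [t * k + j]. *)
Lemma gterm_eq0 (t j : nat) : (k <= j + t)%N -> gterm k A t j = 0.
Proof.
move=> le_k; rewrite /gterm big_pred0 // => c; rewrite !inE.
apply/negbTE; rewrite negb_and; apply/orP; right.
have : (\sum_(i < t.+1) (tnth c i).+1 <= t.+1 * k)%N.
  rewrite -[X in (_ <= X * _)%N](card_ord t.+1) -sum_nat_const.
  by apply: leq_sum => i _; apply: ltn_ord.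
under eq_bigr do rewrite -addn1.
by rewrite big_split /= sum_nat_const card_ord; lia.
Qed.

Lemma gtermS_trunc (t j : nat) : (j < k)%N ->
  gterm k A t.+1 j =
  \sum_(j.+1 <= i < k) A i *m invmx (A k) *m gterm k A t (j + k - i).
Proof.
move=> j_lt; rewrite gtermS.
rewrite -(big_mkord (fun i => (0 < i)%N)
  (fun i => A i *m invmx (A k) *m gterm k A t (j + k - i))).
(* A first entry [i <= j] leaves an offset [j + k - i >= k], which no tuple attains. *)
rewrite (big_cat_nat (n := j.+1)) //= big_nat_cond big1 ?add0r; last first.
  move=> i ltij; rewrite gterm_eq0 ?mulmx0 //; lia.
rewrite [LHS]big_nat_cond [RHS]big_nat_cond.
by apply: eq_bigl => i; lia.
Qed.

Lemma gsum_widen (j m : nat) : (k <= j + m)%N ->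
  gsum k A j = \sum_(1 <= t < m) (-1) ^+ t.-1 *: gterm k A t j.
Proof.
move=> le_k; rewrite /gsum.
case: (ltnP 0 (k - j)) => [j_lt | j_ge].
  rewrite [RHS](big_cat_nat (n := (k - j)%N)) //=; last lia.
  rewrite [X in _ + X]big_nat_cond [X in _ + X]big1 ?addr0 // => t lt_t.
  by rewrite gterm_eq0 ?scaler0 //; lia.
rewrite big_geq; last lia.
rewrite big_nat_cond big1 // => t lt_t.
by rewrite gterm_eq0 ?scaler0 //; lia.
Qed.

Lemma gsum_rec (j : nat) : (j < k)%N ->
  gsum k A j =
  \sum_(j.+1 <= i < k)
    A i *m invmx (A k) *m (A (j + k - i)%N - gsum k A (j + k - i)).
Proof.
(* A bound on [t] independent of the offset lets the two sums be exchanged. *)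
move=> j_lt; rewrite (@gsum_widen _ k.+1); last lia.
rewrite big_add1 /=.
under eq_bigr do rewrite gtermS_trunc // scaler_sumr.
rewrite exchange_big /=; apply: eq_big_nat => i lt_i.
under eq_bigr do rewrite scalemxAr.
rewrite -mulmx_sumr; congr (_ *m _).
(* The term [t = 0] yields [A (j + k - i)]; in the others, the sign shifted by one yields minus
   [gsum] at the same offset. *)
rewrite big_ltn; last lia.
rewrite expr0 scale1r gterm0; last lia.
congr (_ + _); rewrite (@gsum_widen _ k) ?leq_addl // -sumrN.
apply: eq_big_nat => -[|t] // _.
by rewrite /= exprS mulN1r scaleNr.
Qed.

Lemma convolution_recursion_equiv (m : nat -> 'M[K]_n) : A k \in unitmx ->
  (forall j, (j < k)%N -> A j = - \sum_(j.+1 <= i < k.+1) A i *m m (i - j)%N)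
  <->
  (forall j, (j < k)%N -> A j = - (A k *m m (k - j)%N) + gsum k A j).
Proof.
move=> Ak_unit.
(* The two right-hand sides agree at [j] once the closed form holds strictly above [j]. One
   direction is then immediate, the other an induction on [k - j]. *)
have step j : (j < k)%N ->
    (forall i, (j < i < k)%N ->
       A i = - (A k *m m (k - i)%N) + gsum k A i) ->
    - \sum_(j.+1 <= i < k.+1) A i *m m (i - j)%N =
    - (A k *m m (k - j)%N) + gsum k A j.
  move=> j_lt closed; rewrite big_nat_recr //= opprD addrC gsum_rec //.
  congr (_ + _); rewrite -sumrN; apply: eq_big_nat => i lt_i.
  (* As [j < j + k - i < k], the closed form turns the bracket into [- (A k *m m (i - j))], whose
     [A k] cancels the inverse. *)
  rewrite [A (j + k - i)%N]closed; last lia.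
  rewrite addrK mulmxN mulmxA mulmxKV //.
  by congr (- (_ *m m _)); lia.
split=> rec j j_lt; last first.
  by rewrite step // => [|i /andP[_]]; apply: rec.
have [d le_d] := ubnP (k - j); elim: d j j_lt le_d => // d IHd j j_lt le_d.
by rewrite rec // step // => i lt_i; apply: IHd; lia.
Qed.

End ConvolutionRecursion.

Theorem corollary2p6 (R : realType) (f : scalar_kind) (s : star_kind)
  (n k : nat) (n_ge1 : (1 <= n)%N) (k_ge2 : (2 <= k)%N)
  (eps1 eps2 : scalars R f)
  (eps1P : eps1 = 1 \/ eps1 = -1) (eps2P : eps2 = 1 \/ eps2 = -1)
  (X : 'M[scalars R f]_(n, k * n)) (J : 'M[scalars R f]_(k * n))
  (XL_unit : stack_mx X J \in unitmx)
  (Gamma : 'M[scalars R f]_(k * n)) (Gamma_unit : Gamma \in unitmx)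
  (Gamma_star : star_mx s Gamma = eps2 *: Gamma)
  (Gamma_J : Gamma *m star_mx s J = (eps1 * eps2) *: (J *m Gamma))
  (XJGX0 : forall r : nat, (r <= k - 2)%N ->
     X *m J ^+ r *m Gamma *m star_mx s X = 0)
  (XJGX_unit : X *m J ^+ (k - 1) *m Gamma *m star_mx s X \in unitmx)
  (A : nat -> 'M[scalars R f]_n) :
  (A k = invmx (X *m J ^+ (k - 1) *m Gamma *m star_mx s X) /\
   forall j : nat, (j <= k - 1)%N ->
     A j = - \sum_(j.+1 <= i < k.+1)
               A i *m X *m J ^+ (k - j + i - 1) *m Gamma *m star_mx s X *m A k)
  <->
  [/\ A k = invmx (X *m J ^+ (k - 1) *m Gamma *m star_mx s X),
      A (k - 1)%N = - (A k *m X *m J ^+ k *m Gamma *m star_mx s X *m A k)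
    & forall j : nat, (j <= k - 2)%N ->
        A j = - (A k *m X *m J ^+ (2 * k - j - 1) *m Gamma
                   *m star_mx s X *m A k) + gsum k A j].
Proof.
set G := Gamma; set Y := star_mx s X.
pose m p := X *m J ^+ (k - 1 + p) *m G *m Y *m A k.
have recE j : (j < k)%N ->
    \sum_(j.+1 <= i < k.+1) A i *m X *m J ^+ (k - j + i - 1) *m G *m Y *m A k =
    \sum_(j.+1 <= i < k.+1) A i *m m (i - j)%N.
  move=> j_lt; apply: eq_big_nat => i lt_i; rewrite /m !mulmxA.
  by congr (_ *m J ^+ _ *m _ *m _ *m _); lia.
(* The exponent [p] is kept free because for [j = k - 1] it is written [k]. *)
have closedE j p : (j < k)%N -> p = (2 * k - j - 1)%N ->
    A k *m X *m J ^+ p *m G *m Y *m A k = A k *m m (k - j)%N.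
  move=> j_lt ->; rewrite /m !mulmxA.
  by congr (_ *m J ^+ _ *m _ *m _ *m _); lia.
(* Hence the separate formula for [A (k - 1)] is an instance of the general closed form. *)
have gsum_last : gsum k A (k - 1) = 0 by rewrite /gsum big_geq //; lia.
(* Invertibility of [A k] follows from its formula, which both systems contain. *)
have equiv (AkE : A k = invmx (X *m J ^+ (k - 1) *m G *m Y)) :=
  @convolution_recursion_equiv _ n k A m
    (eq_ind_r (fun B => B \in unitmx) (etrans (unitmx_inv _) XJGX_unit) AkE).
split=> [[AkE rec] | [AkE last_eq closed]].
  have /(equiv AkE) closed j : (j < k)%N ->
      A j = - \sum_(j.+1 <= i < k.+1) A i *m m (i - j)%N.
    by move=> j_lt; rewrite -recE // rec //; lia.
  split=> // [|j le_j].
    rewrite (closedE (k - 1)%N); try lia.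
    by rewrite {1}closed ?gsum_last ?addr0 //; lia.
  rewrite (closedE j) //; last lia.
  by apply: closed; lia.
split=> // j le_j; rewrite recE; last lia.
apply: (equiv AkE).2; last lia.
move=> i i_lt; have [->|ne_i] := eqVneq i (k - 1)%N.
  by rewrite gsum_last addr0 {1}last_eq (closedE (k - 1)%N) //; lia.
by rewrite closed ?(closedE i) //; lia.
Qed.
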